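(* Consider the network control setting, the centralized-information problem $(\mathrm{C})$ and the partially-nested-information problem $(\mathrm{PN})$ described in the context. Then $(\mathrm{PN})$ is a conservative approximation of $(\mathrm{C})$ in the following sense: every feasible solution $(\Phi_{i,t})_{i\in\mathcal M,t\in\mathcal T}$ of $(\mathrm{PN})$ is feasible in $(\mathrm{C})$ (where $\Phi_{i,t}$, a function of $\boldsymbol\xi_{\overline{\mathcal N}_i}^{t-1}$, is regarded as the function of $\boldsymbol\xi_{\mathcal M}^{t-1}$ that ignores the components $\boldsymbol\xi_j^{t-1}$ with $j\notin\overline{\mathcal N}_i$), and the optimal value of $(\mathrm{PN})$ is larger than or equal to the optimal value of $(\mathrm{C})$.
   Context: **Network.** $\mathcal M=\{1,\dots,M\}$ is a set of agents, $\mathcal T=\{1,\dots,T\}$, $\mathcal T_+=\mathcal T\cup\{T+1\}$. A directed graph on $\mathcal M$ is given; an arc from $j$ to $i$ means the states of agent $j$ affect the dynamics of agent $i$. $\mathcal N_i\subset\mathcal M$ is the set of $j$ having an arc to $i$ (neighbors of $i$). $\overline{\mathcal N}_i$ is the set consisting of $i$ and all its precedent agents, i.e. all $j$ from which there is a directed path to $i$; thus $\mathcal N_i\subseteq\overline{\mathcal N}_i$ and $\overline{\mathcal N}_j\subseteq\overline{\mathcal N}_i$ for $j\in\mathcal N_i$. **Notation.** For vectors $v_{i,t}$: $\boldsymbol v_{\mathcal A,t}=[v_{j,t}]_{j\in\mathcal A}$ for $\mathcal A\subseteq\mathcal M$; $\boldsymbol v_i^t=[v_{i,1},\dots,v_{i,t}]$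 is the history up to $t$ (empty for $t=0$); $\boldsymbol v_{\mathcal A}^t=[\boldsymbol v_j^t]_{j\in\mathcal A}$; $\boldsymbol v_i$ is the concatenation over the whole horizon. **Dynamics.** Agent $i$ has states $x_{i,t}\in\mathbb R^{n_{x,i}}$ ($t\in\mathcal T_+$), inputs $u_{i,t}\in\mathbb R^{n_{u,i}}$ and uncertainties $\xi_{i,t}\in\mathbb R^{n_{\xi,i}}$ ($t\in\mathcal T$), with $x_{i,1}$ known and $$x_{i,t+1}=A_{i,t}x_{i,t}+B_{i,t}\boldsymbol x_{\mathcal N_i,t}+D_{i,t}u_{i,t}+E_{i,t}\xi_{i,t},\qquad t\in\mathcal T,$$ where $A_{i,t},B_{i,t},D_{i,t},E_{i,t}$ are known matrices of full column rank. With $\boldsymbol x_i=[x_{i,t}]_{t\in\mathcal T_+}$, $\boldsymbol u_i=[u_{i,t}]_{t\in\mathcal T}$, $\boldsymbol\xi_i=[\xi_{i,t}]_{t\in\mathcal T}$, these recursions are written $\boldsymbol x_i=f_i(\boldsymbol x_{\mathcal N_i},\boldsymbol u_i,\boldsymbol\xi_i)$. **Constraints and objective.** $\mathcal O_i=\{(\boldsymbol x_i,\boldsymbol u_i): H_{x,i}\boldsymbol x_i+H_{u,i}\boldsymbol u_i\le h_i\}$ and $J_i(\boldsymbol x_i,\boldsymbol u_i)=\sum_{t=1}^T(\|Q_ix_{i,t}\|_q+\|R_iu_{i,t}\|_q)$ with $q\in\{1,\infty\}$, for given $H_{x,i},H_{u,i},h_i,Q_i,R_i$. **Uncertainty.**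 $\boldsymbol\xi_i\in\Xi_i$, a nonempty compact polyhedron; $\Xi_{\mathcal M}=\prod_{i\in\mathcal M}\Xi_i$ and $\Xi_{\overline{\mathcal N}_i}=\prod_{j\in\overline{\mathcal N}_i}\Xi_j$. **Problem (C).** The decision variables are functions $\Pi_{i,t}$ ($i\in\mathcal M$, $t\in\mathcal T$) of $\boldsymbol\xi_{\mathcal M}^{t-1}$ with values in $\mathbb R^{n_{u,i}}$. Minimize $\sum_{i=1}^M\max_{\boldsymbol\xi_{\mathcal M}\in\Xi_{\mathcal M}}J_i(\boldsymbol x_i,\boldsymbol u_i)$ subject to, for all $\boldsymbol\xi_{\mathcal M}\in\Xi_{\mathcal M}$ and all $i\in\mathcal M$: $u_{i,t}=\Pi_{i,t}(\boldsymbol\xi_{\mathcal M}^{t-1})$ for $t\in\mathcal T$, $\boldsymbol x_i=f_i(\boldsymbol x_{\mathcal N_i},\boldsymbol u_i,\boldsymbol\xi_i)$, $(\boldsymbol x_i,\boldsymbol u_i)\in\mathcal O_i$. **Problem (PN).** The decision variables are functions $\Phi_{i,t}$ of $\boldsymbol\xi_{\overline{\mathcal N}_i}^{t-1}$ with values in $\mathbb R^{n_{u,i}}$. Minimize $\sum_{i=1}^M\max_{\boldsymbol\xi_{\overline{\mathcal N}_i}\in\Xi_{\overline{\mathcal N}_i}}J_i(\boldsymbol x_i,\boldsymbol u_i)$ subject to, for all $i\in\mathcal M$ and all $\boldsymbol\xi_{\overline{\mathcal N}_i}\in\Xi_{\overline{\mathcal N}_i}$: $u_{i,t}=\Phi_{i,t}(\boldsymbol\xi_{\overline{\mathcal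 N}_i}^{t-1})$ for $t\in\mathcal T$, $\boldsymbol x_i=f_i(\boldsymbol x_{\mathcal N_i},\boldsymbol u_i,\boldsymbol\xi_i)$, $(\boldsymbol x_i,\boldsymbol u_i)\in\mathcal O_i$. (Under such policies $x_{i,t}$ depends only on $\boldsymbol\xi_{\overline{\mathcal N}_i}^{t-1}$, so this is well defined.) **Conventions.** Policies are arbitrary functions; ''max'' is understood as supremum in $[0,\infty]$; the optimal value is the infimum of the objective over feasible solutions ($+\infty$ if there are none). *)

(* Defs.v *)
From HB Require Import structures.
From mathcomp Require Import all_boot all_order all_algebra.
From mathcomp Require Import all_classical all_reals all_analysis.

Set Implicit Arguments.
Unset Strict Implicit.
Unset Printing Implicit Defensive.
Import Order.TTheory GRing.Theory Num.Theory.
Import numFieldNormedType.Exports.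
Local Open Scope classical_set_scope.
Local Open Scope ring_scope.

Definition lev (R : realType) n (v w : 'cV[R]_n) : Prop :=
  forall k, v k 0 <= w k 0.

Definition polyhedron (R : realType) n (P : set 'cV[R]_n) : Prop :=
  exists m (G : 'M[R]_(m, n)) (g : 'cV[R]_m), P = [set v | lev (G *m v) g].

Inductive norm_index := norm_one | norm_infty.

(* [mx_norm] is the largest absolute value of an entry. *)
Definition vnorm (R : realType) (q : norm_index) n (v : 'cV[R]_n) : R :=
  match q with
  | norm_one => \sum_(k < n) `|v k 0|
  | norm_infty => mx_norm v
  end.

Definition neighbors M (arc : rel 'I_M) (i : 'I_M) : {set 'I_M} :=
  [set j | arc j i]%SET.

(* [connect] is reflexive, so that i is always one of its precedents. *)
Definition precedents M (arc : rel 'I_M) (i : 'I_M) : {set 'I_M} :=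
  [set j | connect arc j i]%SET.

(* Agents and times are numbered from 0: time t : 'I_horizon stands for t + 1,
   and states live on 'I_horizon.+1.  [Bm i t] acts on the vector stacking the
   states of the neighbors of i, [Hx i] and [Hu i] on the vectors stacking the
   whole state and input trajectories of i, and [Xi i] is a set of stacked
   uncertainty trajectories of i. *)
Record network (R : realType) := Network {
  agents : nat;
  horizon : nat;
  arc : rel 'I_agents;
  nx : 'I_agents -> nat;
  nu : 'I_agents -> nat;
  nxi : 'I_agents -> nat;
  init : forall i, 'cV[R]_(nx i);
  Am : forall i, 'I_horizon -> 'M[R]_(nx i);
  Bm : forall i, 'I_horizon ->
    'M[R]_(nx i, \sum_(k < #|neighbors arc i|) nx (enum_val k));
  Dm : forall i, 'I_horizon -> 'M[R]_(nx i, nu i);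
  Em : forall i, 'I_horizon -> 'M[R]_(nx i, nxi i);
  nh : 'I_agents -> nat;
  Hx : forall i, 'M[R]_(nh i, \sum_(t < horizon.+1) nx i);
  Hu : forall i, 'M[R]_(nh i, \sum_(t < horizon) nu i);
  hrhs : forall i, 'cV[R]_(nh i);
  nQ : 'I_agents -> nat;
  nR : 'I_agents -> nat;
  Qm : forall i, 'M[R]_(nQ i, nx i);
  Rm : forall i, 'M[R]_(nR i, nu i);
  qnorm : norm_index;
  Xi : forall i, set 'cV[R]_(\sum_(t < horizon) nxi i)
}.
Arguments arc {R} n.
Arguments Xi {R n} i _.

Section Network.
Variables (R : realType) (net : network R).
Local Notation M := (agents net).
Local Notation T := (horizon net).
Local Notation nbrs := (neighbors (arc net)).
Local Notation prec := (precedents (arc net)).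

Definition step (i : 'I_M) (t : 'I_T) (x : 'cV[R]_(nx i))
    (xN : forall k : 'I_#|nbrs i|, 'cV[R]_(nx (enum_val k)))
    (u : 'cV[R]_(nu i)) (xi : 'cV[R]_(nxi i)) : 'cV[R]_(nx i) :=
  Am i t *m x + Bm i t *m (\mxcol_k xN k) + Dm i t *m u + Em i t *m xi.

Definition local_constraints (i : 'I_M) (x : 'I_T.+1 -> 'cV[R]_(nx i))
    (u : 'I_T -> 'cV[R]_(nu i)) : Prop :=
  lev (Hx i *m (\mxcol_t x t) + Hu i *m (\mxcol_t u t)) (hrhs i).

Definition cost (i : 'I_M) (x : 'I_T.+1 -> 'cV[R]_(nx i))
    (u : 'I_T -> 'cV[R]_(nu i)) : R :=
  \sum_(t < T) (vnorm (qnorm net) (Qm i *m x (widen_ord (leqnSn T) t))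
                + vnorm (qnorm net) (Rm i *m u t)).

(* The uncertainties of the agents in S over the first t time steps; at time
   t : 'I_T (t + 1 counting from 1) these are exactly the strictly past ones. *)
Definition history (S : {set 'I_M}) (t : nat) :=
  forall j, j \in S -> 'I_t -> 'cV[R]_(nxi j).

Definition restrict (S S' : {set 'I_M}) (sSS' : S \subset S') t
    (h : history S' t) : history S t :=
  fun j jS => h j (fintype.subsetP sSS' j jS).

Definition past (S : {set 'I_M}) (t : 'I_T) (xi : history S T) : history S t :=
  fun j jS s => xi j jS (widen_ord (ltnW (ltn_ord t)) s).
Arguments past {S} t xi.

Definition uncertainty (S : {set 'I_M}) : set (history S T) :=
  [set xi | forall j (jS : j \in S), Xi j (\mxcol_t xi j jS t)].
Arguments uncertainty S xi : clear implicits.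

(* Which agents' uncertainties each agent observes.  The last condition
   makes the states of the neighbors of i functions of the uncertainties observed by i. *)
Record information := Information {
  info :> 'I_M -> {set 'I_M};
  info_self : forall i, i \in info i;
  info_nested : forall i j, j \in nbrs i -> info j \subset info i
}.

Lemma centralized_self (i : 'I_M) : i \in [set: 'I_M]%SET.
Proof. by rewrite inE. Qed.

Lemma centralized_nested (i j : 'I_M) :
  j \in nbrs i -> [set: 'I_M]%SET \subset [set: 'I_M]%SET.
Proof. by []. Qed.

Definition centralized : information :=
  @Information (fun _ => [set: 'I_M]%SET) centralized_self centralized_nested.

Lemma partially_nested_self (i : 'I_M) : i \in prec i.
Proof. by rewrite inE connect0. Qed.

Lemma partially_nested_nested (i j : 'I_M) :
  j \in nbrs i -> prec j \subset prec i.
Proof.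
rewrite inE => ji; apply/fintype.subsetP => k; rewrite !inE => kj.
exact: connect_trans kj (connect1 ji).
Qed.

Definition partially_nested : information :=
  Information partially_nested_self partially_nested_nested.

Section Problem.
Variable I : information.

Definition policy :=
  forall (i : 'I_M) (t : 'I_T), history (I i) t -> 'cV[R]_(nu i).

Definition input (Pi : policy) i (xi : history (I i) T) (t : 'I_T) :
    'cV[R]_(nu i) :=
  Pi i t (past t xi).

Fixpoint state_at (Pi : policy) (t : nat) :
    (t <= T)%N -> forall i, history (I i) T -> 'cV[R]_(nx i) :=
  match t with
  | 0 => fun _ i _ => init i
  | s.+1 => fun (lt_sT : (s < T)%N) i xi =>
      step (Ordinal lt_sT)
        (state_at Pi (ltnW lt_sT) xi)
        (fun k => state_at Pi (ltnW lt_sT)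
                    (restrict (info_nested I (enum_valP k)) xi))
        (input Pi xi (Ordinal lt_sT))
        (xi i (info_self I i) (Ordinal lt_sT))
  end.

Definition state (Pi : policy) i (xi : history (I i) T) (t : 'I_T.+1) :
    'cV[R]_(nx i) :=
  state_at Pi (leq_ord t) xi.

Definition feasible (Pi : policy) : Prop :=
  forall i (xi : history (I i) T), uncertainty (I i) xi ->
    local_constraints (state Pi xi) (input Pi xi).

(* Costs are nonnegative, so over nonempty uncertainty sets these suprema are
   suprema in [0, +oo]. *)
Definition objective (Pi : policy) : \bar R :=
  (\sum_(i < M)
    ereal_sup [set (cost (state Pi xi) (input Pi xi))%:E
                | xi in uncertainty (I i)])%E.

Definition optimal_value : \bar R :=
  ereal_inf [set objective Pi | Pi in feasible].

(* The states are the solution of the dynamics under the policy Pi, the states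
   of the neighbors being evaluated at the uncertainties that they observe. *)
Lemma state0 (Pi : policy) i (xi : history (I i) T) :
  state Pi xi ord0 = init i.
Proof. by []. Qed.

Lemma stateS (Pi : policy) i (xi : history (I i) T) (t : 'I_T) :
  state Pi xi (lift ord0 t) =
  step t (state Pi xi (widen_ord (leqnSn T) t))
    (fun k => state Pi (restrict (info_nested I (enum_valP k)) xi)
                (widen_ord (leqnSn T) t))
    (input Pi xi t) (xi i (info_self I i) t).
Proof.
case: t => t lt_tT; rewrite /state /=.
rewrite (bool_irrelevance (leq_ord (lift ord0 (Ordinal lt_tT))) lt_tT) /=.
pose w := widen_ord (leqnSn T) (Ordinal lt_tT).
by rewrite (bool_irrelevance (leq_ord w) (ltnW lt_tT)).
Qed.

End Problem.

Definition centralize (Phi : policy partially_nested) : policy centralized :=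
  fun i t h => Phi i t (restrict (finset.subsetT (prec i)) h).

End Network.

(* Main.v *)
(* By induction on time, the state of agent i under the centralized policy is
   its state under the partially nested one at the restricted uncertainty.
   Restrictions of uncertainties are uncertainties, so each constraint and each
   cost value of (C) already occurs in (PN). *)
Require Import Defs.
From HB Require Import structures.
From mathcomp Require Import all_boot all_order all_algebra.
From mathcomp Require Import all_classical all_reals all_analysis.

Set Implicit Arguments.
Unset Strict Implicit.
Unset Printing Implicit Defensive.
Import Order.TTheory GRing.Theory Num.Theory.
Import numFieldNormedType.Exports.
Local Open Scope classical_set_scope.
Local Open Scope ring_scope.

Section Restriction.
Variables (R : realType) (net : network R).

(** Different chains of restrictions reach the same agent with different membership proofs;
    membership is boolean, so these proofs coincide. *)
Lemma history_irrelevance (S : {set 'I_(agents net)}) t (h : history S t) j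
    (p q : j \in S) : h j p = h j q.
Proof. by rewrite (bool_irrelevance p q). Qed.

Lemma restrict_trans (S S' S'' : {set 'I_(agents net)}) (sSS' : S \subset S')
    (sS'S'' : S' \subset S'') (sSS'' : S \subset S'') t (h : history S'' t) :
  Defs.restrict sSS' (Defs.restrict sS'S'' h) = Defs.restrict sSS'' h.
Proof.
by apply: functional_extensionality_dep => j; apply/funext => jS;
  exact: (history_irrelevance h).
Qed.

Lemma restrict_id (S : {set 'I_(agents net)}) (sSS : S \subset S) t
    (h : history S t) : Defs.restrict sSS h = h.
Proof.
by apply: functional_extensionality_dep => j; apply/funext => jS;
  exact: (history_irrelevance h).
Qed.

(** The uncertainty set is a product over agents, so forgetting some factors preserves
    membership. *)
Lemma uncertainty_restrict (S S' : {set 'I_(agents net)})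
    (sSS' : S \subset S') (xi : history S' (horizon net)) :
  uncertainty xi -> uncertainty (Defs.restrict sSS' xi).
Proof. by move=> xiS' j jS; exact: xiS'. Qed.

End Restriction.

Section Centralize.
Variables (R : realType) (net : network R).
Variable Phi : policy (partially_nested net).
Implicit Type i : 'I_(agents net).

Local Notation local_part i xi :=
  (Defs.restrict (finset.subsetT (precedents (Defs.arc net) i)) xi).

Lemma state_at_centralize t (le_tT : (t <= horizon net)%N) i
    (xi : history [set: 'I_(agents net)]%SET (horizon net)) :
  state_at (I := centralized net) (centralize Phi) le_tT xi =
  state_at (I := partially_nested net) Phi le_tT (local_part i xi).
Proof.
(* The agent stays general, since the next state of [i] involves the current states of its
   neighbors. *)
elim: t le_tT i => [//|t IHt] lt_tT i /=.
(* The inputs agree by computation, because [past] and [restrict] commute definitionally; the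
   neighbors' states and the current uncertainty remain. *)
rewrite IHt; congr (step _ _ _ _ _).
  apply: functional_extensionality_dep => k.
  (* The centralized neighbor keeps the whole history, while the nested one receives it through the
     precedents of [i], which include its own. *)
  by rewrite restrict_id IHt (restrict_trans _ _ (finset.subsetT _)).
by rewrite /Defs.restrict (history_irrelevance xi (centralized_self i)
  (fintype.subsetP (finset.subsetT _) i (partially_nested_self i))).
Qed.

Lemma state_centralize i
    (xi : history [set: 'I_(agents net)]%SET (horizon net)) :
  state (I := centralized net) (i := i) (centralize Phi) xi =
  state (I := partially_nested net) Phi (local_part i xi).
Proof. by apply/funext => t; exact: state_at_centralize. Qed.

Lemma feasible_centralize : feasible Phi -> feasible (centralize Phi).
Proof.
(* Only the states need rewriting: the inputs are already convertible. *)
move=> feasPhi i xi xiXi; rewrite state_centralize.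
exact: feasPhi (uncertainty_restrict _ xiXi).
Qed.

Lemma objective_centralize : (objective (centralize Phi) <= objective Phi)%E.
Proof.
apply: lee_sum => i _; apply: le_ereal_sup => _ [xi xiXi <-].
exists (local_part i xi); first exact: uncertainty_restrict.
by rewrite state_centralize.
Qed.

End Centralize.

Theorem theorem1 (R : realType) (net : network R)
    (Am_rank : forall (i : 'I_(agents net)) (t : 'I_(horizon net)),
      row_full (Am i t))
    (Bm_rank : forall (i : 'I_(agents net)) (t : 'I_(horizon net)),
      row_full (Bm i t))
    (Dm_rank : forall (i : 'I_(agents net)) (t : 'I_(horizon net)),
      row_full (Dm i t))
    (Em_rank : forall (i : 'I_(agents net)) (t : 'I_(horizon net)),
      row_full (Em i t))
    (Xi_nonempty : forall i : 'I_(agents net), Xi i !=set0)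
    (Xi_compact : forall i : 'I_(agents net), compact (Xi i))
    (Xi_polyhedron : forall i : 'I_(agents net), polyhedron (Xi i)) :
  (forall Phi : policy (partially_nested net),
     feasible Phi -> feasible (centralize Phi)) /\
  (optimal_value (centralized net) <= optimal_value (partially_nested net))%E.
Proof.
split=> [Phi|]; first exact: feasible_centralize.
(* It suffices to bound each feasible objective value from below, which is vacuous when there is
   none. *)
apply: le_ereal_inf_tmp => _ [Phi feasPhi <-].
apply: le_trans (objective_centralize Phi).
by apply: ereal_inf_lbound; exists (centralize Phi) => //;
  exact: feasible_centralize.
Qed.
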